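(* Let $m$ be a positive integer. For $\Psi,\nu\in\mathbb{R}$ put $$Z(\Psi,\nu)=\sum_{k=0}^m \frac{e^{\Psi k}}{[k!(m-k)!]^\nu},\qquad g(\Psi,\nu)=\phi(\Psi)\,\phi(\nu-1),$$ where $\phi(x)=\frac{1}{\sqrt{2\pi}}e^{-x^2/2}$. Then for all real numbers $a,b,c$, $$K^{-1}(a,b,c)=\int_{-\infty}^{\infty}\int_{-\infty}^{\infty} g(\Psi,\nu)\,e^{\Psi a-b\nu}\,Z(\Psi,\nu)^{-c}\,d\Psi\,d\nu<\infty .$$
   Context: $K^{-1}(a,b,c)$ is just notation for the displayed double integral. It is the normalizing integral of the conjugate prior density $g(\Psi,\nu)e^{\Psi a-b\nu}Z(\Psi,\nu)^{-c}K(a,b,c)$ for the Conway-Maxwell-Binomial distribution on $\{0,\dots,m\}$, whose mass function in the parameters $\Psi=\log(p/(1-p))$ and $\nu$ is $k\mapsto \frac{e^{\Psi k}}{[k!(m-k)!]^{\nu}}\big/Z(\Psi,\nu)$. *)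

(* Defs.v *)
From HB Require Import structures.
From mathcomp Require Import all_boot all_order all_algebra.
From mathcomp Require Import all_classical all_reals all_analysis.
Set Implicit Arguments.
Unset Strict Implicit.
Unset Printing Implicit Defensive.
Import Order.TTheory GRing.Theory Num.Theory.
Import numFieldNormedType.Exports.
Local Open Scope ring_scope.

Definition phi (R : realType) (x : R) : R :=
  (Num.sqrt (2 * pi))^-1 * expR (- (x ^+ 2) / 2).

(* The exponent of the factorials is real, hence powR. *)
Definition Z (R : realType) (m : nat) (Psi nu : R) : R :=
  \sum_(k < m.+1) expR (Psi * k%:R) / ((k`! * (m - k)`!)%:R `^ nu).

Definition g (R : realType) (Psi nu : R) : R := phi Psi * phi (nu - 1).

(* The integrand is nonnegative, so the iterated Lebesgue integral always
   exists in [0, +oo]; Psi is the inner variable. *)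
Definition Kinv (R : realType) (m : nat) (a b c : R) : \bar R :=
  (\int[@lebesgue_measure R]_(nu in setT)
     \int[@lebesgue_measure R]_(Psi in setT)
       (g Psi nu * expR (Psi * a - b * nu) * Z m Psi nu `^ (- c))%:E)%E.

(* Main.v *)
Require Import Defs.
From HB Require Import structures.
From mathcomp Require Import all_boot all_order all_algebra.
From mathcomp Require Import all_classical all_reals all_analysis.
From mathcomp Require Import measurable_realfun ring lra.
Set Implicit Arguments.
Unset Strict Implicit.
Unset Printing Implicit Defensive.
Import Order.TTheory GRing.Theory Num.Theory.
Local Open Scope ring_scope.

(** Every factor [k! (m - k)!] lies between [1] and [m!], so
    [`|ln Z| <= m + m `|Psi| + ln(m!) `|nu|].  Hence [Z^(-c)], like
    [e^(Psi a - b nu)], grows at most exponentially in [`|Psi|] and [`|nu|],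
    and the Gaussian weight [g] absorbs it: the integrand is dominated by a
    constant times a product of two centred normal densities of variance 2. *)

(* Unlike [ge0_le_integral], no measurability is required: the integral of a
   nonnegative function is a supremum over the simple functions below it. *)
Lemma ge0_le_integral_nomeas d (T : measurableType d) (R : realType)
    (mu : {measure set T -> \bar R}) (f1 f2 : T -> \bar R) :
  (forall x, (0 <= f1 x)%E) -> (forall x, (f1 x <= f2 x)%E) ->
  (\int[mu]_(x in setT) f1 x <= \int[mu]_(x in setT) f2 x)%E.
Proof.
move=> f10 f12; have f20 x : (0 <= f2 x)%E by exact: le_trans (f12 x).
rewrite !ge0_integralE// !patch_setT.
apply: ereal_sup_le => _ [h hf1 <-]; exists h => //= x.
exact: le_trans (f12 x).
Qed.

Lemma fact_mul_fact_le (m k : nat) : (k <= m)%N -> (k`! * (m - k)`! <= m`!)%N.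
Proof. by move=> km; rewrite -(bin_fact km) leq_pmull// bin_gt0. Qed.

(** Completing the square. The weight [1 / 4] is chosen because [- x ^+ 2 / 2 + x ^+ 2 / 4] is the
    exponent of a centred normal density of variance 2. *)
Lemma mul_norm_le_sqr (R : realFieldType) (a x : R) : a * `|x| <= a ^+ 2 + x ^+ 2 / 4.
Proof.
rewrite -(real_normK (num_real x)).
have := sqr_ge0 (a - `|x| / 2); nra.
Qed.

Section Z_bounds.
Variables (R : realType) (m : nat).
Implicit Types Psi nu a b c x : R.

Let L : R := ln m`!%:R.

Lemma ln_fact_ge0 : 0 <= L.
Proof. by rewrite ln_ge0// ler1n fact_gt0. Qed.

Lemma powR_fact_le (k : nat) nu : (k <= m)%N ->
  ((k`! * (m - k)`!)%:R `^ nu)^-1 <= expR (L * `|nu|).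
Proof.
move=> km; have n0 : (0 < k`! * (m - k)`!)%N by rewrite muln_gt0 !fact_gt0.
rewrite /powR pnatr_eq0 gtn_eqF// -expRN ler_expR.
apply: le_trans (ler_norm _) _.
rewrite normrN normrM mulrC ler_wpM2r// ger0_norm ?ln_ge0 ?ler1n//.
by rewrite ler_ln ?posrE ?ltr0n ?fact_gt0// ler_nat fact_mul_fact_le.
Qed.

Lemma Z_term_gt0 Psi nu (k : nat) :
  0 < expR (Psi * k%:R) / ((k`! * (m - k)`!)%:R `^ nu).
Proof. by rewrite divr_gt0 ?expR_gt0// powR_gt0// ltr0n muln_gt0 !fact_gt0. Qed.

(** The term [k = 0] alone suffices: it equals [m!] to the power [- nu], free of [Psi], and the
    other terms are positive. *)
Lemma Z_ge Psi nu : expR (- (L * `|nu|)) <= Z m Psi nu.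
Proof.
rewrite /Z big_ord_recl /= mulr0 expR0 mul1r subn0 fact0 mul1n.
rewrite -[leLHS]addr0 lerD//; last first.
  by apply: sumr_ge0 => i _; exact/ltW/Z_term_gt0.
rewrite /powR pnatr_eq0 gtn_eqF ?fact_gt0// -expRN ler_expR lerN2 mulrC.
by rewrite ler_wpM2l ?ln_fact_ge0// ler_norm.
Qed.

Lemma Z_le Psi nu : Z m Psi nu <= expR (m%:R + m%:R * `|Psi| + L * `|nu|).
Proof.
apply: (@le_trans _ _ (\sum_(k < m.+1) expR (m%:R * `|Psi| + L * `|nu|))).
  apply: ler_sum => k _; rewrite expRD ler_pM ?expR_ge0 ?invr_ge0 ?powR_ge0//.
    rewrite ler_expR; apply: le_trans (ler_norm _) _.
    rewrite normrM mulrC normr_nat.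
    by apply: ler_wpM2r => //; rewrite ler_nat -ltnS.
  by rewrite powR_fact_le// -ltnS.
(* The [m + 1] equal terms are absorbed by [m + 1 <= expR m], which keeps the bound a single
   exponential. *)
rewrite sumr_const card_ord -[leLHS]mulr_natl -addrA [leRHS]expRD.
rewrite ler_wpM2r ?expR_ge0//.
by rewrite -natr1 addrC expR_ge1Dx.
Qed.

(** The sign of [c] is arbitrary, so [ln Z] must be bounded on both sides. *)
Lemma powR_Z_le Psi nu c :
  Z m Psi nu `^ (- c) <= expR (`|c| * (m%:R + m%:R * `|Psi| + L * `|nu|)).
Proof.
have Z0 : 0 < Z m Psi nu by apply: lt_le_trans (Z_ge _ _); exact: expR_gt0.
rewrite /powR gt_eqF// ler_expR; apply: le_trans (ler_norm _) _.
rewrite normrM normrN ler_wpM2l// ler_norml.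
rewrite -ler_expR -(ler_expR (ln _)) lnK ?posrE// Z_le andbT.
apply: le_trans (Z_ge Psi nu); rewrite ler_expR lerN2 lerDr.
by rewrite addr_ge0 ?mulr_ge0.
Qed.

Lemma integrand_le a b c : exists2 C : R, 0 <= C & forall Psi nu,
  g Psi nu * expR (Psi * a - b * nu) * Z m Psi nu `^ (- c) <=
  C * normal_pdf 0 (Num.sqrt 2) Psi * normal_pdf 0 (Num.sqrt 2) nu.
Proof.
have s0 : Num.sqrt 2 != 0 :> R by rewrite gt_eqF// sqrtr_gt0.
pose p : R := normal_peak (Num.sqrt 2).
have p0 : 0 < p by exact: normal_peak_gt0.
pose q : R := (Num.sqrt (2 * pi))^-1.
have q0 : 0 <= q by rewrite invr_ge0.
(* [al] and [be] are the total coefficients of [|Psi|] and [|nu|] in the exponent. The [1] in [be]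
   is the cross term of [(nu - 1) ^+ 2 / 2]. *)
pose al : R := `|a| + `|c| * m%:R.
pose be : R := 1 + `|b| + `|c| * L.
pose K : R := `|c| * m%:R + al ^+ 2 + be ^+ 2.
(* [q ^+ 2] comes from the two factors [phi]; dividing by [p ^+ 2] cancels the peaks of the two
   dominating densities. *)
exists (q ^+ 2 * expR K / p ^+ 2).
  exact: divr_ge0 (mulr_ge0 (sqr_ge0 _) (expR_ge0 _)) (sqr_ge0 _).
move=> Psi nu.
rewrite !normal_pdfE// /normal_fun !subr0 sqr_sqrtr//.
have -> : forall u v : R, q ^+ 2 * expR K / p ^+ 2 * (p * u) * (p * v) =
    q ^+ 2 * (expR K * u * v).
  by move=> u v; field; rewrite gt_eqF.
rewrite /g /phi -/q.
have -> : forall u v w z : R,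
    q * u * (q * v) * w * z = q ^+ 2 * (u * v * w * z).
  by move=> *; ring.
rewrite ler_wpM2l ?sqr_ge0//.
apply: le_trans (ler_wpM2l _ (powR_Z_le _ _ _)) _.
  by rewrite !mulr_ge0 ?expR_ge0.
rewrite -!expRD ler_expR.
have Ha : Psi * a <= `|a| * `|Psi|.
  by rewrite mulrC -normrM ler_norm.
have Hb : - (b * nu) <= `|b| * `|nu|.
  by rewrite -normrM -normrN ler_norm.
have Hn := ler_norm nu.
have HPsi := mul_norm_le_sqr al Psi.
have Hnu := mul_norm_le_sqr be nu.
rewrite /K; move: HPsi Hnu; rewrite -/L /al /be.
lra.
Qed.

End Z_bounds.

Theorem theorem1 (R : realType) (m : nat) (hm : (0 < m)%N) (a b c : R) :
  (Kinv m a b c < +oo)%E.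
Proof.
have [C C0 dom] := integrand_le m a b c.
pose f : R -> R := normal_pdf 0 (Num.sqrt 2).
have f0 x : 0 <= f x by exact: normal_pdf_ge0.
have integralZ k : 0 <= k ->
    (\int[@lebesgue_measure R]_(x in setT) (k%:E * (f x)%:E) = k%:E)%E.
  move=> k0; rewrite ge0_integralZl_EFin//.
  - by rewrite integral_normal_pdf mule1.
  - by move=> x _; rewrite lee_fin.
  - by apply/measurable_EFinP; exact: measurable_normal_pdf.
have F0 Psi nu :
    0 <= g Psi nu * expR (Psi * a - b * nu) * Z m Psi nu `^ (- c).
  by rewrite !mulr_ge0 ?expR_ge0 ?powR_ge0 ?invr_ge0 ?sqrtr_ge0.
apply: (@le_lt_trans _ _ C%:E); last exact: ltry.
(* Since [f] has total mass 1, [C] becomes the integral of [C * f nu], and below [C * f nu] that of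
   [C * f nu * f Psi], so both layers compare pointwise. *)
rewrite -(integralZ C)// /Kinv.
apply: ge0_le_integral_nomeas => nu.
  by apply: integral_ge0 => Psi _; rewrite lee_fin.
rewrite -EFinM -(integralZ (C * f nu)) ?mulr_ge0//.
apply: ge0_le_integral_nomeas => Psi; first by rewrite lee_fin.
by rewrite -EFinM lee_fin [leRHS]mulrAC; exact: dom.
Qed.
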